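(* Let $v\in\mathbb{N}\setminus\{1\}$ and let $h\colon\mathbb{N}_2\to\mathbb{C}$ be a $v$-transitive light weight such that $v\in V(h)$. Suppose that $E_{h,v}(1)_1$, $D_h(1)_1$, $C_{h,v}(1)_1$, $B_{h,v}(1)_1$, $B_h(1)_1$ and $A_{h,v}(1)_1$ exist. Then $$A_{h,v}(1)_1\in D_h(1)_1\cdot\mathrm{sqrt}\Big(1-\frac{B_{h,v}(1)_1}{B_h(1)_1}\Big),$$ where if $B_h(1)_1=0$ then also $B_{h,v}(1)_1=0$, the quotient $\frac{0}{0}$ is interpreted as $1$, and $A_{h,v}(1)_1=0$.
   Context: $\mathbb{N}=\{1,2,\dots\}$, $\mathbb{N}_0=\{0,1,2,\dots\}$, and $\mathbb{N}_2=\{e\subset\mathbb{N}:|e|=2\}$. A weight is a map $h\colon\mathbb{N}_2\to\mathbb{C}$. A walk of length $n\in\mathbb{N}_0$ is a tuple $w=\langle v_0,\dots,v_n\rangle$ of elements of $\mathbb{N}$ with $v_{i-1}\ne v_i$ for $i=1,\dots,n$; its weight is $h(w)=\prod_{i=1}^n h(\{v_{i-1},v_i\})$ (and $h(w)=1$ if $n=0$). A series $\sum_{x\in X}g(x)$ over an at most countable set $X$ converges absolutely if the sums $\sum_{x\in Y}|g(x)|$ over finite $Y\subset X$ are bounded. For a set $W$ of walks, $h(W)$ denotes the sum of $\sum_{w\in W}h(w)$ when it converges absolutely. $W(n)$ is the set of walks of length $n$ with $v_0=1$. The weight $h$ is light if $\sum_{w\in W(n)}h(w)$ converges absolutely for every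 $n\in\mathbb{N}_0$. $V(h)$ is the set of vertices $u\in\mathbb{N}$ such that some walk starting at $1$ and ending at $u$ has nonzero weight. For $v\in\mathbb{N}\setminus\{1\}$, $h$ is $v$-transitive if there is a bijection $f\colon\mathbb{N}\to\mathbb{N}$ with $f(1)=v$ and $h(\{f(a),f(b)\})=h(\{a,b\})$ for all $\{a,b\}\in\mathbb{N}_2$. Define formal power series in $\mathbb{C}[[x]]$ (coefficient of $x^n$ given): $A_{h,v}$: $h(W(v,n))$, where $W(v,n)$ is the set of walks in $W(n)$ visiting $v$; $B_h$: weight of walks of length $n$ with $v_0=v_n=1$; $B_{h,v}$: weight of walks of length $n$ with $v_0=v_n=1$ and $v_i\ne v$ for all $i$; $C_{h,v}$: weight of walks of length $n$ with $v_0=1$, $v_n=v$, $v_i\ne v$ for $i<n$; $D_h$: $h(W(n))$; $E_{h,v}$: weight of walks of length $n$ with $v_0=1$, $v_n=v$ and $v_i\notin\{1,v\}$ for $0<i<n$. For $U(x)=\sum_{n\ge0}u_nx^n\in\mathbb{C}[[x]]$, we say $U(1)_1$ exists if $\lim_{n\to\infty}\sum_{j=0}^nu_j$ exists in $\mathbb{C}$, and $U(1)_1$ denotes this limit. For $w,z\in\mathbb{C}$, $w\cdot\mathrm{sqrt}(z)=\{w\alpha:\alpha\in\mathbb{C},\ \alpha^2=z\}$. *)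

(* Defs.v *)
From mathcomp Require Import all_boot all_order all_algebra finmap.
From mathcomp Require Import all_classical all_reals all_analysis.
From mathcomp Require Import summability.

Set Implicit Arguments.
Unset Strict Implicit.
Unset Printing Implicit Defensive.

Import Order.TTheory GRing.Theory Num.Theory.
Import numFieldNormedType.Exports.

Local Open Scope classical_set_scope.
Local Open Scope ring_scope.

(* Everything is stated over a numFieldType [K], on which the library provides
   the topology given by the norm; the intended instance is [K := R[i]] for
   [R : realType]. *)

(* The vertices are the positive integers. *)
Definition vertex : Type := {n : nat | (0 < n)%N}.

Definition vertex1 : vertex := exist _ 1%N isT.

(* The two-element sets of vertices. *)
Definition edge : Type := {e : {fset vertex} | #|` e|%fset == 2%N}.

Definition weight (K : numFieldType) : Type := edge -> K.

(* h({a, b}); the value 0 for a = b is a dummy, since consecutive vertices of a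
   walk are distinct. *)
Definition edge_weight (K : numFieldType) (h : weight K) (a b : vertex) : K :=
  if insub [fset a; b]%fset is Some e then h e else 0.

(* The walk <v_0, ..., v_n> is the sequence [:: v_0; ...; v_n], so that its
   length n is one less than its size. *)
Definition is_walk (n : nat) (w : seq vertex) : Prop :=
  size w = n.+1 /\ sorted (fun a b => a != b) w.

(* The vertex v_i of the walk w. *)
Definition vtx (w : seq vertex) (i : nat) : vertex := nth vertex1 w i.

Definition walk_weight (K : numFieldType) (h : weight K) (w : seq vertex) : K :=
  \prod_(0 <= i < (size w).-1) edge_weight h (vtx w i) (vtx w i.+1).

Definition abs_convergent (K : numFieldType) (T : choiceType) (X : set T)
    (g : T -> K) : Prop :=
  exists M : K, forall Y : {fset T}, [set` Y] `<=` X ->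
    \sum_(x <- Y) `|g x| <= M.

(* The sum of g over X, as the limit of the sums over finite subsets along
   inclusion; only meaningful when the series converges. *)
Definition set_sum (K : numFieldType) (T : choiceType) (X : set T)
    (g : T -> K) : K :=
  summability.sum (R := K^o) (g \_ X).

Definition weight_of (K : numFieldType) (h : weight K) (W : set (seq vertex)) : K :=
  set_sum W (walk_weight h).

Definition walks1 (n : nat) : set (seq vertex) :=
  [set w | is_walk n w /\ vtx w 0 = vertex1].

Definition light (K : numFieldType) (h : weight K) : Prop :=
  forall n, abs_convergent (walks1 n) (walk_weight h).

(* V(h) *)
Definition reachable (K : numFieldType) (h : weight K) : set vertex :=
  [set u | exists n w,
    [/\ walks1 n w, vtx w n = u & walk_weight h w != 0]].

Definition transitive_at (K : numFieldType) (h : weight K) (v : vertex) : Prop :=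
  exists f : vertex -> vertex,
    [/\ bijective f, f vertex1 = v &
        forall a b, a != b -> edge_weight h (f a) (f b) = edge_weight h a b].

(* A formal power series is given by its sequence of coefficients. *)
Definition fps (K : numFieldType) : Type := nat -> K.

Definition A_ser (K : numFieldType) (h : weight K) (v : vertex) : fps K :=
  fun n => weight_of h [set w | walks1 n w /\ v \in w].

Definition B_ser (K : numFieldType) (h : weight K) : fps K :=
  fun n => weight_of h [set w | walks1 n w /\ vtx w n = vertex1].

Definition Bv_ser (K : numFieldType) (h : weight K) (v : vertex) : fps K :=
  fun n => weight_of h [set w | [/\ walks1 n w, vtx w n = vertex1 &
    forall i, (i <= n)%N -> vtx w i != v]].

Definition C_ser (K : numFieldType) (h : weight K) (v : vertex) : fps K :=
  fun n => weight_of h [set w | [/\ walks1 n w, vtx w n = v &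
    forall i, (i < n)%N -> vtx w i != v]].

Definition D_ser (K : numFieldType) (h : weight K) : fps K :=
  fun n => weight_of h (walks1 n).

Definition E_ser (K : numFieldType) (h : weight K) (v : vertex) : fps K :=
  fun n => weight_of h [set w | [/\ walks1 n w, vtx w n = v &
    forall i, (0 < i < n)%N -> vtx w i != vertex1 /\ vtx w i != v]].

Definition partial_sums (K : numFieldType) (U : fps K) : nat -> K :=
  fun n => \sum_(0 <= j < n.+1) U j.

(* U(1)_1 exists *)
Definition exists_at1 (K : numFieldType) (U : fps K) : Prop :=
  cvgn (partial_sums U).

(* U(1)_1 *)
Definition at1 (K : numFieldType) (U : fps K) : K := limn (partial_sums U).

(* w . sqrt(z) *)
Definition times_sqrt (K : numFieldType) (w z : K) : set K :=
  [set w * a | a in [set a : K | a ^+ 2 = z]].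

(* The quotient a / b, with 0 / 0 read as 1. *)
Definition quot (K : numFieldType) (a b : K) : K :=
  if (a == 0) && (b == 0) then 1 else a / b.

(* Main.v *)
Require Import Defs.
From mathcomp Require Import all_boot all_order all_algebra.
From mathcomp Require Import finmap complex.
From mathcomp Require Import all_classical all_reals all_analysis.
From mathcomp Require Import summability ring zify.

(* Write A, B, B_v, C, D, E for the formal power series of the statement.
   Cutting a walk at its first visit to v, or at its last visit to 1, gives
     A = C D,   C = B_v E,   B = B_v + C (C B),
   because v-transitivity identifies the series of walks based at v with those
   based at 1, and reversal turns walks from v to 1 into walks from 1 to v.
   A product of convergent series may diverge, but if u, v, w and the Cauchy
   product u v w all converge then the sums multiply: the threefold convolution
   of the partial sums, divided by (n + 1)(n + 2) / 2, tends to the product of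
   the sums, and it is also the Cesaro mean of order 2 of the product series.
   Hence A(1) = C(1) D(1) and B(1) - B_v(1) = C(1)^2 B(1), so that C(1) is the
   required square root if B(1) <> 0; if B(1) = 0, then B_v(1) = 0, and
   C(1) = B_v(1) E(1) = 0. *)

Set Implicit Arguments.
Unset Strict Implicit.
Unset Printing Implicit Defensive.

Import Order.TTheory GRing.Theory Num.Theory.
Import numFieldNormedType.Exports.

Local Open Scope classical_set_scope.
Local Open Scope ring_scope.

Local Notation cplx R := (complex R : numFieldType).

(** * Sums over countable sets *)

Existing Instance totally_filter.

(** Carries the limit as an argument, because [set_sum] takes a default value when the finite sums
    do not converge. *)
Definition has_sum (K : numFieldType) (T : choiceType) (f : T -> K) (l : K) :=
  partial_sum (R := K^o) f @ totally --> (l : K^o).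

Lemma has_sumP (K : numFieldType) (T : choiceType) (f : T -> K) (l : K) :
  has_sum f l <-> forall e, 0 < e -> exists A : {fset T}, forall B : {fset T},
    (A `<=` B)%fset -> `|l - \sum_(x <- B) f x| < e.
Proof.
rewrite /has_sum (cvgrPdist_lt (V := K^o)); split => sumf e /sumf.
  by case=> A _ AP; exists A => B /AP; rewrite /= /partial_sum big_seq_fsetE.
by case=> A AP; exists A => // B /AP; rewrite /= /partial_sum big_seq_fsetE.
Qed.

Lemma has_sum_set_sum (K : numFieldType) (T : choiceType) (X : set T)
    (f : T -> K) (l : K) :
  has_sum (f \_ X) l -> set_sum X f = l.
Proof. by apply: (cvg_lim (T := K^o)); exact: norm_hausdorff. Qed.

Lemma has_sum0 (K : numFieldType) (T : choiceType) :
  has_sum (fun=> 0 : K) (0 : K) (T := T).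
Proof.
apply/has_sumP => e e0; exists fset0 => B _.
by rewrite big1 // subr0 normr0.
Qed.

Lemma has_sumD (K : numFieldType) (T : choiceType) (f g : T -> K) (a b : K) :
  has_sum f a -> has_sum g b -> has_sum (fun x => f x + g x) (a + b).
Proof.
move=> fa gb; rewrite /has_sum.
rewrite (_ : partial_sum _ = partial_sum (R := K^o) f \+ partial_sum (R := K^o) g).
  exact: (@cvgD K K^o).
by apply/funext => A; rewrite /partial_sum big_split.
Qed.

Lemma has_sumZ (K : numFieldType) (T : choiceType) (c : K) (f : T -> K) (a : K) :
  has_sum f a -> has_sum (fun x => c * f x) (c * a).
Proof.
move=> fa; rewrite /has_sum.
rewrite (_ : partial_sum _ = (fun A => c * partial_sum (R := K^o) f A)).
  exact: (@cvgM K _ _ _ (fun=> c) (partial_sum (R := K^o) f) c a (cvg_cst c) fa).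
by apply/funext => A; rewrite /partial_sum mulr_sumr.
Qed.

Lemma has_sum_sum (K : numFieldType) (T : choiceType) n (f : nat -> T -> K)
    (a : nat -> K) :
  (forall i, (i < n)%N -> has_sum (f i) (a i)) ->
  has_sum (fun x => \sum_(i < n) f i x) (\sum_(i < n) a i).
Proof.
elim: n => [|n IHn] fa.
  rewrite big_ord0 (_ : (fun _ => _) = fun=> 0); first exact: has_sum0.
  by apply/funext => x; rewrite big_ord0.
rewrite big_ord_recr /= (_ : (fun _ => _) =
  fun x => \sum_(i < n) f i x + f n x); last first.
  by apply/funext => x; rewrite big_ord_recr.
by apply: has_sumD; [apply: IHn => i /ltnW; exact: fa|exact: fa].
Qed.

(** Once [B] contains the preimages of the points of [A] in [Y], its sum equals the sum over [A]
    together with the image of [B] cut down to [X]: the further points of [A] lie outside [Y] and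
    contribute 0. *)
Lemma has_sum_reindex (K : numFieldType) (S T : choiceType) (X : set S)
    (Y : set T) (h : S -> T) (f : T -> K) (l : K) :
  set_bij X Y h -> has_sum (f \_ Y) l -> has_sum ((f \o h) \_ X) l.
Proof.
move=> [hXY hinj hsurj] /has_sumP sumf; apply/has_sumP => e /sumf [A AP].
(* Preimages are chosen in [option S], which asks for no default element of [S]; [pmap k A] then
   contains the preimages of all points of [A] in [Y]. *)
have /choice [k kP] : forall y, exists o : option S, Y y ->
    exists x, [/\ o = Some x, X x & h x = y].
  move=> y; have [Yy|nYy] := pselect (Y y); last by exists None.
  by have [x Xx hx] := hsurj _ Yy; exists (Some x) => _; exists x.
exists [fset x in pmap k A]%fset => B /fsubsetP AB.
pose B1 := [fset x in B | `[< X x >]]%fset.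
pose hB1 := [fset h x | x in B1]%fset.
have := AP (hB1 `|` A)%fset (fsubsetUr _ _).
rewrite (_ : \sum_(x <- (_ `|` _)%fset) _ = \sum_(x <- B) ((f \o h) \_ X) x)//.
have injB1 : {in B1 &, injective h}.
  move=> x y; rewrite !inE => /andP[_ /asboolP Xx] /andP[_ /asboolP Xy].
  by apply: hinj; rewrite inE.
have B1B : (B1 `<=` B)%fset by apply/fsubsetP => x; rewrite !inE => /andP[].
rewrite -(big_fset_incl _ B1B); last first.
  move=> x xB; rewrite !inE xB /= => /asboolP nXx.
  by rewrite patchE memNset.
have hB1U : (hB1 `<=` hB1 `|` A)%fset by exact: fsubsetUl.
rewrite -(big_fset_incl _ hB1U); last first.
  move=> y; rewrite inE => /orP[->//|yA] yhB.
  rewrite patchE; case: ifPn => // /set_mem Yy.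
  have [x [kyx Xx hx]] := kP _ Yy.
  case/negP: yhB; apply/imfsetP; exists x => //=.
  rewrite !inE; apply/andP; split; last exact/asboolP.
  apply: AB; rewrite inE /= mem_pmap -kyx; apply/mapP; exists y => //.
rewrite big_imfset //= big_seq [RHS]big_seq; apply: eq_bigr => x.
rewrite !inE => /andP[_ /asboolP Xx].
by rewrite !patchE /= !mem_set //; exact: hXY.
Qed.

(** * Summability from bounded absolute sums *)

Lemma ler_sum_fset (K : numDomainType) (T : choiceType) (f : T -> K)
    (A B : {fset T}) :
  (forall x, 0 <= f x) -> (A `<=` B)%fset ->
  \sum_(x <- A) f x <= \sum_(x <- B) f x.
Proof.
move=> f0 /fsubsetP AB; rewrite [leRHS](big_fsetID _ (mem A)) /=.
rewrite [X in _ <= X + _](_ : _ = \sum_(x <- A) f x).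
  by rewrite lerDl sumr_ge0.
by apply: eq_fbigl => x; rewrite !inE andb_idl //; exact: AB.
Qed.

(** The finite sums increase along inclusion, so they converge to their supremum. *)
Lemma has_sum_ge0 (R : realType) (T : choiceType) (f : T -> R) (M : R) :
  (forall x, 0 <= f x) -> (forall A : {fset T}, \sum_(x <- A) f x <= M) ->
  exists l, has_sum f l.
Proof.
move=> f0 fM; pose E := [set \sum_(x <- A) f x | A in @setT {fset T}].
have supE : has_sup E.
  split; first by exists (\sum_(x <- fset0) f x); exists fset0.
  by exists M => _ [A _ <-].
exists (sup E); apply/has_sumP => e e0.
have [_ [A _ <-] supA] := sup_adherent e0 supE.
exists A => B AB.
have leB : \sum_(x <- B) f x <= sup E by apply: sup_upper_bound => //; exists B.
rewrite ger0_norm ?subr_ge0 // ltrBlDr addrC -ltrBlDr (lt_le_trans supA) //.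
exact: ler_sum_fset.
Qed.

(** Writes [f] as the difference of [|f| + f] and [|f|], two nonnegative families with bounded
    finite sums. *)
Lemma has_sum_abs (R : realType) (T : choiceType) (f : T -> R) (M : R) :
  (forall A : {fset T}, \sum_(x <- A) `|f x| <= M) -> exists l, has_sum f l.
Proof.
move=> fM; have [a fa] := has_sum_ge0 (fun x => normr_ge0 (f x)) fM.
have [x|A|b fb] := @has_sum_ge0 R T (fun x => `|f x| + f x) (M + M).
- by rewrite -lerBlDr sub0r ler_normr lexx orbT.
- rewrite big_split lerD // (le_trans _ (fM A)) // ler_sum // => x _.
  exact: ler_norm.
exists (b + -1 * a); have := has_sumD fb (has_sumZ (c := -1) fa).
by under eq_fun do rewrite mulN1r addrAC subrr add0r.
Qed.

Lemma has_sum_real_complex (R : realType) (T : choiceType) (f : T -> R) (a : R) :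
  has_sum f a -> has_sum (fun x => (f x)%:C%C) (a%:C)%C.
Proof.
move=> /has_sumP fa; apply/has_sumP => e.
(* In the order of [R[i]] a positive [e] is real, so its real part serves as the tolerance. *)
rewrite ltcE => /andP[/eqP Ime Ree]; have [A AP] := fa _ Ree.
exists A => B /AP; rewrite -raddf_sum -raddfB /= normc_def /= expr0n addr0.
by rewrite sqrtr_sqr ltcE /= Ime eqxx.
Qed.

(** Real and imaginary parts are dominated by the modulus, so each forms an absolutely summable real
    family. *)
Lemma abs_convergent_has_sum (R : realType) (T : choiceType) (X : set T)
    (f : T -> cplx R) :
  abs_convergent X f -> exists l, has_sum (f \_ X) l.
Proof.
case=> M fM; set g := f \_ X.
have gM (A : {fset T}) : \sum_(x <- A) `|g x| <= M.
  pose A1 := [fset x in A | x \in X]%fset.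
  have A1A : (A1 `<=` A)%fset by apply/fsubsetP => x; rewrite !inE => /andP[].
  have A1X : [set` A1] `<=` X by move=> x /=; rewrite !inE => /andP[_] /set_mem.
  rewrite -(big_fset_incl _ A1A); last first.
    by move=> x xA; rewrite !inE xA /= => nX; rewrite /g patchE (negbTE nX) normr0.
  apply: le_trans (fM _ A1X); rewrite big_seq [leRHS]big_seq; apply: ler_sum => x.
  by rewrite !inE => /andP[_ xX]; rewrite /g patchE xX.
have part (p : cplx R -> R) : (forall z, `|p z|%:C%C <= `|z|) ->
    exists l, has_sum (p \o g) l.
  (* The bound [M] lies in [R[i]]; comparing real parts turns it into a real bound. *)
  move=> pz; apply: (@has_sum_abs _ _ _ (complex.Re M)) => A.
  have : (\sum_(x <- A) `|(p \o g) x|)%:C%C <= M.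
    apply: le_trans (gM A).
    by rewrite raddf_sum ler_sum // => x _; exact: pz.
  by rewrite lecE => /andP[].
have [a ga] := part (@complex.Re R) (@normc_ge_Re R).
have [|b gb] := part (@complex.Im R).
  (* Up to sign, [Im z] is the real part of [z] times ['i], which has the same modulus as [z]. *)
  move=> z; rewrite -normrN -ReiNIm (le_trans (normc_ge_Re _)) //.
  by rewrite normrM [X in _ * X]normc_def /= expr0n expr1n add0r sqrtr1 mulr1.
exists (a%:C%C + 'i%C * b%:C%C).
have := has_sumD (has_sum_real_complex ga)
  (has_sumZ (c := 'i%C) (has_sum_real_complex gb)).
by under eq_fun do rewrite -complexE.
Qed.

Lemma abs_convergent_sub (K : numFieldType) (T : choiceType) (X Y : set T)
    (f : T -> K) :
  X `<=` Y -> abs_convergent Y f -> abs_convergent X f.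
Proof. by move=> XY [M fM]; exists M => A AX; apply: fM => x /AX /XY. Qed.

Lemma abs_convergent_bij (K : numFieldType) (S T : choiceType) (X : set S)
    (Y : set T) (h : S -> T) (f : T -> K) :
  set_bij X Y h -> abs_convergent Y f -> abs_convergent X (f \o h).
Proof.
move=> [hXY hinj _] [M fM]; exists M => A AX.
have <- : \sum_(y <- [fset h x | x in A]%fset) `|f y| = \sum_(x <- A) `|(f \o h) x|.
  by rewrite big_imfset // => x y xA yA; apply: hinj; rewrite inE; exact: AX.
by apply: fM => y /imfsetP[x /= /AX Xx ->]; exact: hXY.
Qed.

(** * Products of absolutely convergent families *)

Lemma big_fsetM_mul (K : pzSemiRingType) (S T : choiceType) (A : {fset S})
    (B : {fset T}) (f : S -> K) (g : T -> K) :
  \sum_(p <- (A `*` B)%fset) f p.1 * g p.2 =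
  (\sum_(x <- A) f x) * \sum_(y <- B) g y.
Proof.
rewrite big_distrl /=; under [RHS]eq_bigr do rewrite big_distrr.
by rewrite /fsetM big_imfset2 //= => -[x y] [x' y'] _ _ /= [-> ->].
Qed.

(** A finite set of pairs lies in the rectangle of its two projections, over which the sum of
    absolute values factors. *)
Lemma abs_convergent_prod (K : numFieldType) (S T : choiceType) (X : set S)
    (Y : set T) (f : S -> K) (g : T -> K) :
  abs_convergent X f -> abs_convergent Y g ->
  abs_convergent (X `*` Y) (fun p => f p.1 * g p.2).
Proof.
move=> [M fM] [N gN]; exists (M * N) => A AXY.
pose A1 := [fset p.1 | p in A]%fset; pose A2 := [fset p.2 | p in A]%fset.
have AA : (A `<=` A1 `*` A2)%fset.
  apply/fsubsetP => p pA; rewrite in_fsetM; apply/andP.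
  by split; apply/imfsetP; exists p.
apply: le_trans (ler_sum_fset (f := fun p => `|f p.1 * g p.2|) _ AA) _ => //.
under eq_bigr do rewrite normrM.
rewrite (big_fsetM_mul A1 A2 (fun x => `|f x|) (fun x => `|g x|)).
apply: ler_pM; rewrite ?sumr_ge0 //.
  by apply: fM => _ /imfsetP[p /= /AXY [? ?] ->].
by apply: gN => _ /imfsetP[p /= /AXY [? ?] ->].
Qed.

(** The family of products has some sum [c] by absolute convergence; the finite sums over rectangles
    tend both to [c] and to [a * b]. *)
Lemma has_sum_prod (R : realType) (S T : choiceType) (X : set S) (Y : set T)
    (f : S -> cplx R) (g : T -> cplx R) a b :
  abs_convergent X f -> abs_convergent Y g ->
  has_sum (f \_ X) a -> has_sum (g \_ Y) b ->
  has_sum ((fun p => f p.1 * g p.2) \_ (X `*` Y)) (a * b).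
Proof.
move=> absf absg fa gb.
have [c fgc] := abs_convergent_has_sum (abs_convergent_prod absf absg).
suff -> : a * b = c by [].
set K := cplx R.
pose F := partial_sum (R := K^o) (f \_ X).
pose G := partial_sum (R := K^o) (g \_ Y).
pose P := partial_sum (R := K^o) ((fun p => f p.1 * g p.2) \_ (X `*` Y)).
have PFG : (fun AB : {fset S} * {fset T} => F AB.1 * G AB.2) =
    P \o (fun AB => AB.1 `*` AB.2)%fset.
  apply/funext => -[A B] /=; rewrite /P /F /G /partial_sum.
  rewrite -!(big_seq_fsetE _ _ xpredT) -big_fsetM_mul /=; apply: eq_bigr => -[x y] _ /=.
  by rewrite /patch in_setX /=; do 2![case: (_ \in _)]; rewrite /= ?mulr0 ?mul0r.
have FGab : (fun AB => F AB.1 * G AB.2) @ (filter_prod totally totally) -->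
    (a * b : K^o).
  apply: (@cvgM K _ _ _ (F \o fst) (G \o snd)).
    exact: (cvg_comp _ _ (@cvg_fst _ _ totally totally _) fa).
  exact: (cvg_comp _ _ (@cvg_snd _ _ totally totally _) gb).
have FGc : (fun AB => F AB.1 * G AB.2) @ (filter_prod totally totally) -->
    (c : K^o).
  (* Rectangles are cofinal: one contains [A] as soon as its sides contain the projections of
     [A]. *)
  rewrite PFG; apply: cvg_comp _ _ _ fgc => /= U [A _ AU].
  exists ([set B | [fset p.1 | p in A] `<=` B]%fset,
          [set B | [fset p.2 | p in A] `<=` B]%fset) => /=.
    by split; [exists [fset p.1 | p in A]%fset | exists [fset p.2 | p in A]%fset].
  move=> [B C] /= [/fsubsetP AB /fsubsetP AC]; apply: AU => /=.
  apply/fsubsetP => p pA; rewrite in_fsetM; apply/andP; split.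
    by apply: AB; apply/imfsetP; exists p.
  by apply: AC; apply/imfsetP; exists p.
by apply: (cvg_unique _ FGab FGc); exact: (@norm_hausdorff _ K^o).
Qed.

(** * Cauchy products of convergent series *)

Definition cauchy_prod (K : pzSemiRingType) (u v : nat -> K) (n : nat) : K :=
  \sum_(i < n.+1) u i * v (n - i)%N.

Section cauchy_prod.
Variable K : comNzRingType.
Implicit Types u v w : nat -> K.

(** Truncating the series to polynomials lets the Cauchy product inherit commutativity and
    associativity from the polynomial ring. *)
Lemma coef_poly_cauchy_prod u v n k : (k <= n)%N ->
  ((\poly_(i < n.+1) u i) * \poly_(i < n.+1) v i)`_k = cauchy_prod u v k.
Proof.
move=> kn; rewrite coefM; apply: eq_bigr => i _; rewrite !coef_poly !ltnS.
by rewrite (leq_trans (leq_ord i) kn) (leq_trans (leq_subr _ _) kn).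
Qed.

Lemma cauchy_prodC u v : cauchy_prod u v = cauchy_prod v u.
Proof.
by apply/funext => n; rewrite -!(coef_poly_cauchy_prod _ _ (leqnn n)) mulrC.
Qed.

Lemma cauchy_prodA u v w :
  cauchy_prod u (cauchy_prod v w) = cauchy_prod (cauchy_prod u v) w.
Proof.
apply/funext => n; pose p x := \poly_(i < n.+1) (x i : K).
have <- : (p u * (p v * p w))`_n = cauchy_prod u (cauchy_prod v w) n.
  rewrite coefM; apply: eq_bigr => i _; rewrite coef_poly_cauchy_prod ?leq_subr //.
  by rewrite coef_poly ltn_ord.
rewrite mulrA coefM; apply: eq_bigr => i _; rewrite coef_poly_cauchy_prod ?leq_ord //.
by rewrite coef_poly ltnS leq_subr.
Qed.

Lemma cauchy_prodCA u v w :
  cauchy_prod u (cauchy_prod v w) = cauchy_prod v (cauchy_prod u w).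
Proof. by rewrite !cauchy_prodA (cauchy_prodC u). Qed.

(** Meant for [e] constantly 1: multiplying by it forms partial sums, so the product of three
    sequences of partial sums is the product series summed three times. *)
Lemma cauchy_prod_shuffle u v w e :
  cauchy_prod (cauchy_prod u e)
    (cauchy_prod (cauchy_prod v e) (cauchy_prod w e)) =
  cauchy_prod (cauchy_prod u (cauchy_prod v w)) (cauchy_prod e (cauchy_prod e e)).
Proof.
rewrite -!cauchy_prodA; congr cauchy_prod; rewrite cauchy_prodCA; congr cauchy_prod.
by rewrite cauchy_prodCA [cauchy_prod e (cauchy_prod w _)]cauchy_prodCA.
Qed.

Lemma cauchy_prodDl u v w n :
  cauchy_prod (fun i => u i + v i) w n = cauchy_prod u w n + cauchy_prod v w n.
Proof. by rewrite -big_split; apply: eq_bigr => i _; rewrite mulrDl. Qed.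

Lemma cauchy_prodZl c u v n :
  cauchy_prod (fun i => c * u i) v n = c * cauchy_prod u v n.
Proof. by rewrite mulr_sumr; apply: eq_bigr => i _; rewrite mulrA. Qed.

Lemma cauchy_prod_delta u : cauchy_prod u (fun i => (i == 0%N)%:R) = u.
Proof.
apply/funext => n; rewrite cauchy_prodC /cauchy_prod big_ord_recl subn0 mul1r.
by rewrite big1 ?addr0 // => i _; rewrite mul0r.
Qed.

End cauchy_prod.

Lemma partial_sums_cauchy_prod (K : numFieldType) (u : fps K) :
  partial_sums u = cauchy_prod u (fun=> 1).
Proof.
apply/funext => n; rewrite /partial_sums big_mkord.
by apply: eq_bigr => i _; rewrite mulr1.
Qed.

(** * Cesaro means of order two *)

(** The coefficients of [1 / (1 - x)^3], which count the triples of natural numbers with sum [n]. *)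
Definition cauchy_prod3_weight (K : numFieldType) : nat -> K :=
  cauchy_prod (fun=> 1) (cauchy_prod (fun=> 1) (fun=> 1)).

Lemma cauchy_prod3_weightE (K : numFieldType) n :
  cauchy_prod3_weight K n = n.+1%:R * n.+2%:R / 2%:R.
Proof.
have one m : cauchy_prod (fun=> 1) (fun=> 1) m = m.+1%:R :> K.
  by rewrite /cauchy_prod; under eq_bigr do rewrite mulr1; rewrite sumr_const card_ord.
rewrite /cauchy_prod3_weight cauchy_prodC {1}/cauchy_prod; under eq_bigr do rewrite one mulr1.
elim: n => [|n IHn]; first by rewrite big_ord1 mul1r divff ?pnatr_eq0.
rewrite big_ord_recr /= IHn -[in RHS](natr1 n.+2) -(natr1 n.+1); by field.
Qed.

Lemma norm_cauchy_prod_le (K : numFieldType) (u v : nat -> K) (M : K) n :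
  (forall i, (i <= n)%N -> `|v i| <= M) ->
  `|cauchy_prod u v n| <= M * \sum_(i < n.+1) `|u i|.
Proof.
move=> vM; rewrite (le_trans (ler_norm_sum _ _ _)) // mulr_sumr ler_sum // => i _.
by rewrite normrM mulrC ler_wpM2r // vM // leq_subr.
Qed.

(** The property of the scalars on which the Cesaro argument rests: linear growth overtakes every
    constant. *)
Definition archimedean (K : numFieldType) := forall c e : K,
  0 <= c -> 0 < e -> \forall n \near \oo, c < n.+1%:R * e.

Lemma complex_archimedean (R : realType) : archimedean (cplx R).
Proof.
move=> c e c0; rewrite ltcE => /andP[/eqP /= Ime Ree].
have c_real : (complex.Re c)%:C%C = c by rewrite RRe_real // ger0_real.
have e_real : (complex.Re e)%:C%C = e by case: e Ime {Ree} => x y /= ->.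
have : \forall n \near \oo, complex.Re c / complex.Re e < n.+1%:R.
  apply: filterS (nbhs_infty_gtr (complex.Re c / complex.Re e)) => n /lt_trans; apply.
  by rewrite ltr_nat.
apply: filterS => n; rewrite ltr_pdivrMr // -ltcR c_real.
by rewrite -[X in _ -> _ < _ * X]e_real -(rmorph_nat (real_complex R)) -rmorphM.
Qed.

(** From some [N] on each term is below [e / 2], and the fixed sum of the first [N] norms is
    eventually below [(n + 1) e / 2]. *)
Lemma near_sum_norm_lt (K : numFieldType) (u : nat -> K) e :
  archimedean K -> u @ \oo --> (0 : K) -> 0 < e ->
  \forall n \near \oo, \sum_(i < n.+1) `|u i| < n.+1%:R * e.
Proof.
move=> arch u0 e0; have e20 : 0 < e / 2%:R by rewrite divr_gt0 // ltr0n.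
have [N _ uN] : \forall n \near \oo, `|u n| < e / 2%:R.
  by move/cvgr0Pnorm_lt : u0 => /(_ _ e20).
have sN0 : 0 <= \sum_(i < N) `|u i| by rewrite sumr_ge0.
near=> n; have Nn : (N <= n.+1)%N by near: n; exists N => // n /= /leqW.
rewrite [e]splitr mulrDr.
apply: (@le_lt_trans _ _ (\sum_(i < N) `|u i| + n.+1%:R * (e / 2%:R))).
  rewrite (big_ord_widen _ (fun i => `|u i|) Nn) [X in _ <= X + _]big_mkcond /=.
  have -> : n.+1%:R * (e / 2%:R) = \sum_(i < n.+1) (e / 2%:R).
    by rewrite sumr_const card_ord mulr_natl.
  rewrite -big_split /=.
  apply: ler_sum => i _; case: ltnP => [_|/uN/ltW]; last by rewrite add0r.
  by rewrite lerDl ltW.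
by rewrite ltrD2r; near: n; exact: arch.
Unshelve. all: by end_near. Qed.

(** The product of [v] and [w] is bounded by [M^2 (n + 1)] up to index [n], and the norms of [u] sum
    to [o(n)], while the weight grows like [n^2 / 2]. *)
Lemma cauchy_prod3_cvg0 (K : numFieldType) (u v w : nat -> K) (M : K) :
  archimedean K -> u @ \oo --> (0 : K) ->
  (forall i, `|v i| <= M) -> (forall i, `|w i| <= M) ->
  (fun n => cauchy_prod u (cauchy_prod v w) n / cauchy_prod3_weight _ n)
    @ \oo --> (0 : K).
Proof.
move=> arch u0 vM wM; have M0 : 0 <= M by apply: le_trans (vM 0%N).
apply/cvgr0Pnorm_lt => e e0.
(* This tolerance [d] satisfies [(M^2 + 1) (n + 1)^2 d = e (n + 1)^2 / 2], which is at most [e]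
   times the weight; the added 1 keeps the divisor positive when [M = 0]. *)
have d0 : 0 < e / 2%:R / (M * M + 1) by rewrite !divr_gt0 ?ltr0n // ltr_wpDl ?mulr_ge0.
apply: filterS (near_sum_norm_lt arch u0 d0) => n.
set s := \sum_(i < _) _ => sn.
have s0 : 0 <= s by rewrite sumr_ge0.
have w0 : 0 < cauchy_prod3_weight K n.
  by rewrite cauchy_prod3_weightE !mulr_gt0 ?invr_gt0 ?ltr0n.
rewrite normrM normfV (gtr0_norm w0) ltr_pdivrMr //.
have vw i : (i <= n)%N -> `|cauchy_prod v w i| <= M * M * n.+1%:R.
  move=> i_n; rewrite (le_trans (norm_cauchy_prod_le _ (fun i _ => wM i))) // -mulrA.
  apply: ler_wpM2l => //.
  apply: (@le_trans _ _ (\sum_(j < i.+1) M)); first exact: ler_sum.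
  by rewrite sumr_const card_ord -(mulr_natr M) ler_wpM2l // ler_nat ltnS.
apply: le_lt_trans (norm_cauchy_prod_le u vw) _.
apply: (@le_lt_trans _ _ ((M * M + 1) * n.+1%:R * s)).
  by rewrite ler_wpM2r // ler_wpM2r // lerDl.
have MM0 : 0 < M * M + 1 by rewrite ltr_wpDl ?mulr_ge0.
have : (M * M + 1) * n.+1%:R * s <
    (M * M + 1) * n.+1%:R * (n.+1%:R * (e / 2%:R / (M * M + 1))).
  by rewrite ltr_pM2l // mulr_gt0 // ltr0n.
move/lt_le_trans; apply.
rewrite (_ : _ * _ * (_ * _) = e * (n.+1%:R * n.+1%:R / 2%:R)); last first.
  by field; rewrite gt_eqF.
rewrite cauchy_prod3_weightE ler_pM2l // ler_pM2r ?invr_gt0 ?ltr0n //.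
by rewrite ler_pM2l ?ltr0n // ler_nat.
Qed.

(** Adding the norms of the first [N] terms to [|l| + 1] takes the place of a maximum. *)
Lemma cvg_bounded (K : numFieldType) (u : nat -> K) (l : K) :
  u @ \oo --> l -> exists M : K, forall n, `|u n| <= M.
Proof.
move=> /cvgrPdist_lt /(_ 1 ltr01) [N _ uN].
exists (\sum_(i < N) `|u i| + (`|l| + 1)) => n; have [Nn|nN] := leqP N n.
  have /ltW ulN := uN _ Nn.
  rewrite ler_wpDl ?sumr_ge0 // -[u n](subKr l) (le_trans (ler_normB _ _)) //.
  by rewrite lerD2l.
rewrite ler_wpDr ?addr_ge0 //.
by rewrite (bigD1 (Ordinal nN)) //= lerDl sumr_ge0.
Qed.

Lemma cvg_bounded2 (K : numFieldType) (u v : nat -> K) (a b : K) :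
  u @ \oo --> a -> v @ \oo --> b ->
  exists2 M : K, (forall n, `|u n| <= M) & (forall n, `|v n| <= M).
Proof.
move=> /cvg_bounded[M uM] /cvg_bounded[N vN].
exists (M + N) => n; first by rewrite (le_trans (uM n)) // lerDl (le_trans _ (vN n)).
by rewrite (le_trans (vN n)) // lerDr (le_trans _ (uM n)).
Qed.

(** The factors are replaced by their limits one at a time; each correction is a product of one null
    and two bounded sequences. *)
Lemma cauchy_prod3_cvg (K : numFieldType) (u v w : nat -> K) (a b c : K) :
  archimedean K -> u @ \oo --> a -> v @ \oo --> b -> w @ \oo --> c ->
  (fun n => cauchy_prod u (cauchy_prod v w) n / cauchy_prod3_weight _ n)
    @ \oo --> a * b * c.
Proof.
move=> arch ua vb wc.
have sub0 (x : nat -> K) l : x @ \oo --> l -> (fun n => x n - l) @ \oo --> (0 : K).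
  by move=> xl; apply/subr_cvg0.
have one1 : (fun=> 1 : K) @ \oo --> (1 : K) by exact: cvg_cst.
have [M1 vM1 wM1] := cvg_bounded2 vb wc.
have [M2 oM2 wM2] := cvg_bounded2 one1 wc.
have [M3 oM3 _] := cvg_bounded2 one1 one1.
have T1 := cauchy_prod3_cvg0 arch (sub0 _ _ ua) vM1 wM1.
have T2 := cauchy_prod3_cvg0 arch (sub0 _ _ vb) oM2 wM2.
have T3 := cauchy_prod3_cvg0 arch (sub0 _ _ wc) oM3 oM3.
have w0 n : cauchy_prod3_weight K n != 0.
  by rewrite cauchy_prod3_weightE !mulf_neq0 ?invr_eq0 ?pnatr_eq0.
(* With Cauchy products and 1 for the constant sequence, [u v w = (u - a) v w + a (v - b) 1 w + a b
   (w - c) 1 1 + a b c 1 1 1]; divided by the weight, the last term is [a b c]. *)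
rewrite (_ : (fun n => _) = fun n =>
   cauchy_prod (fun n => u n - a) (cauchy_prod v w) n / cauchy_prod3_weight K n +
   (a * (cauchy_prod (fun n => v n - b) (cauchy_prod (fun=> 1) w) n /
         cauchy_prod3_weight K n) +
   (a * b * (cauchy_prod (fun n => w n - c)
               (cauchy_prod (fun=> 1) (fun=> 1)) n / cauchy_prod3_weight K n) +
    a * b * c))); last first.
  apply/funext => n.
  have lin (x y : nat -> K) l :
      cauchy_prod (fun n => x n - l) y n =
      cauchy_prod x y n - l * cauchy_prod (fun=> 1) y n.
    rewrite (_ : (fun _ => _) = fun n => x n + - l * 1).
      by rewrite cauchy_prodDl cauchy_prodZl mulNr.
    by apply/funext => m; rewrite mulr1.
  rewrite !lin [cauchy_prod v (cauchy_prod _ w)]cauchy_prodCA.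
  rewrite [cauchy_prod w _]cauchy_prodC -[cauchy_prod (cauchy_prod _ _) w]cauchy_prodA.
  rewrite -/(cauchy_prod3_weight K).
  by field; exact: w0.
rewrite -[X in _ --> X]add0r -[X in _ --> 0 + X]add0r -[X in _ --> 0 + (0 + X)]add0r.
apply: cvgD => //; apply: cvgD.
  by rewrite -[X in _ --> X](mulr0 a); apply: cvgM => //; exact: cvg_cst.
apply: cvgD; last exact: cvg_cst.
by rewrite -[X in _ --> X](mulr0 (a * b)); apply: cvgM => //; exact: cvg_cst.
Qed.

Lemma at1_cauchy_prod3 (K : numFieldType) (u v w : fps K) :
  archimedean K -> exists_at1 u -> exists_at1 v -> exists_at1 w ->
  exists_at1 (cauchy_prod u (cauchy_prod v w)) ->
  at1 (cauchy_prod u (cauchy_prod v w)) = at1 u * at1 v * at1 w.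
Proof.
rewrite /exists_at1 /at1 => arch cu cv cw cuvw.
have one1 : (fun=> 1 : K) @ \oo --> (1 : K) by exact: cvg_cst.
(* One limit uses the three sequences of partial sums, the other the partial sums of the product
   with two constant sequences 1; the shuffle identifies the two means. *)
have := cauchy_prod3_cvg arch cu cv cw; have := cauchy_prod3_cvg arch cuvw one1 one1.
rewrite !mulr1 !partial_sums_cauchy_prod cauchy_prod_shuffle.
rewrite -(cauchy_prodA (cauchy_prod u _)) => lim1 lim2.
by apply: (cvg_unique _ lim1 lim2); exact: norm_hausdorff.
Qed.

(** The threefold case with the unit series [d] as third factor, whose partial sums are constantly
    1. *)
Lemma at1_cauchy_prod (K : numFieldType) (u v : fps K) :
  archimedean K -> exists_at1 u -> exists_at1 v -> exists_at1 (cauchy_prod u v) ->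
  at1 (cauchy_prod u v) = at1 u * at1 v.
Proof.
pose d : fps K := fun i => (i == 0%N)%:R.
have dd : partial_sums d = fun=> 1.
  by rewrite partial_sums_cauchy_prod cauchy_prodC cauchy_prod_delta.
have d1 : partial_sums d @ \oo --> (1 : K) by rewrite dd; exact: cvg_cst.
move=> arch cu cv cuv.
have := at1_cauchy_prod3 arch cu cv (w := d); rewrite !cauchy_prod_delta => ->//.
  by rewrite {3}/at1 (cvg_lim _ d1) ?mulr1 //; exact: norm_hausdorff.
by apply/cvg_ex; exists 1.
Qed.

(** * Decompositions of walks *)

(** [walks n vertex1] is convertible to [walks1 n]; other starting points serve for the rest of a
    walk after a visit to [v]. *)
Definition walks (n : nat) (u : vertex) : set (seq vertex) :=
  [set w | is_walk n w /\ vtx w 0 = u].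

Lemma is_walkP n w : is_walk n w <->
  size w = n.+1 /\ forall i, (i < n)%N -> vtx w i != vtx w i.+1.
Proof.
rewrite /is_walk; split=> -[sw].
  by move=> /(sortedP vertex1) wP; split=> // i i_n; apply: wP; rewrite sw.
move=> wP; split=> //; apply/(sortedP vertex1) => i; rewrite sw ltnS; exact: wP.
Qed.

Lemma vtx_take w i k : (k <= i)%N -> vtx (take i.+1 w) k = vtx w k.
Proof. by move=> ki; rewrite /vtx nth_take. Qed.

Lemma vtx_drop w i k : vtx (drop i w) k = vtx w (i + k).
Proof. by rewrite /vtx nth_drop. Qed.

Lemma size_take_walk n (w : seq vertex) i :
  size w = n.+1 -> (i <= n)%N -> size (take i.+1 w) = i.+1.
Proof. by move=> sw i_n; rewrite size_takel // sw. Qed.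

Lemma size_drop_walk n (w : seq vertex) i :
  size w = n.+1 -> (i <= n)%N -> size (drop i w) = (n - i).+1.
Proof. by move=> sw i_n; rewrite size_drop sw subSn. Qed.

(** The vertex at the cut belongs to both pieces, so every step of the walk falls into exactly one
    of them; hence [take i.+1] beside [drop i]. *)
Lemma is_walk_split n i (w : seq vertex) : (i <= n)%N -> size w = n.+1 ->
  is_walk n w <-> is_walk i (take i.+1 w) /\ is_walk (n - i) (drop i w).
Proof.
move=> i_n sw; rewrite !is_walkP (size_take_walk sw i_n) (size_drop_walk sw i_n).
split=> [[_ wP]|[[_ tP] [_ dP]]].
  split; split=> // k ki.
    by rewrite !vtx_take //; [apply: wP; exact: leq_trans i_n|exact: ltnW].
  by rewrite !vtx_drop addnS; apply: wP; rewrite -ltn_subRL.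
split=> // k kn; have [ki|ik] := ltnP k i.
  by have := tP _ ki; rewrite !vtx_take //; exact: ltnW.
have := dP (k - i)%N; rewrite ltn_sub2rE // => /(_ kn).
by rewrite !vtx_drop addnS subnKC.
Qed.

Lemma walk_weight_split (K : numFieldType) (h : weight K) n i (w : seq vertex) :
  (i <= n)%N -> size w = n.+1 ->
  walk_weight h w = walk_weight h (take i.+1 w) * walk_weight h (drop i w).
Proof.
move=> i_n sw; rewrite /walk_weight (size_take_walk sw i_n) (size_drop_walk sw i_n).
rewrite sw !succnK.
rewrite (big_cat_nat (leq0n i) i_n); congr (_ * _).
  by apply: eq_big_nat => k /andP[_ ki]; rewrite !vtx_take ?(ltnW ki).
rewrite -{1}(add0n i) big_addn; apply: eq_big_nat => k _.
by rewrite !vtx_drop addnS addnC.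
Qed.

(** Gluing inverts cutting: [behead] removes the second copy of the shared vertex. *)
Lemma cat_walk_split (u w : seq vertex) i j :
  size u = i.+1 -> size w = j.+1 -> vtx u i = vtx w 0 ->
  [/\ size (u ++ behead w) = (i + j).+1, take i.+1 (u ++ behead w) = u &
      drop i (u ++ behead w) = w].
Proof.
move=> su; case: w => // c w [sw] /= uc; split.
- by rewrite size_cat su sw addSn.
- by rewrite -su take_size_cat.
rewrite drop_cat su ltnSn; move: uc; rewrite /vtx /=.
elim: u i su {sw} => // x u IHu [|i] [su] /=.
  by rewrite (size0nil su) => ->.
exact: IHu.
Qed.

(** If each walk has exactly one admissible cut, at a vertex [c], then [W n] is a disjoint union of
    copies of the products of [P i] and [Q (n - i)], and weights multiply along the cut. *)
Lemma weight_of_concat (R : realType) (h : weight (cplx R))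
    (P Q W : nat -> set (seq vertex)) (c : vertex) :
  (forall i w, P i w -> size w = i.+1 /\ vtx w i = c) ->
  (forall j w, Q j w -> size w = j.+1 /\ vtx w 0 = c) ->
  (forall n w, W n w -> size w = n.+1) ->
  (forall n w, size w = n.+1 -> W n w <->
    exists2 i, (i <= n)%N & P i (take i.+1 w) /\ Q (n - i)%N (drop i w)) ->
  (forall n w i j, size w = n.+1 -> (i < j <= n)%N ->
    P i (take i.+1 w) -> Q (n - i)%N (drop i w) ->
    P j (take j.+1 w) -> Q (n - j)%N (drop j w) -> False) ->
  (forall i, abs_convergent (P i) (walk_weight h)) ->
  (forall j, abs_convergent (Q j) (walk_weight h)) ->
  (fun n => weight_of h (W n)) =
  cauchy_prod (fun i => weight_of h (P i)) (fun j => weight_of h (Q j)).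
Proof.
move=> PP QP sW WP uniqW absP absQ; apply/funext => n; apply: has_sum_set_sum.
pose Wi i := [set w | size w = n.+1 /\ (P i (take i.+1 w) /\ Q (n - i)%N (drop i w))].
have sumWi i : (i < n.+1)%N ->
    has_sum (walk_weight h \_ (Wi i)) (weight_of h (P i) * weight_of h (Q (n - i)%N)).
  rewrite ltnS => i_n.
  have [a Pa] := abs_convergent_has_sum (absP i).
  have [b Qb] := abs_convergent_has_sum (absQ (n - i)%N).
  rewrite /weight_of (has_sum_set_sum Pa) (has_sum_set_sum Qb).
  have PQ := has_sum_prod (absP i) (absQ (n - i)%N) Pa Qb.
  pose split_at (w : seq vertex) := (take i.+1 w, drop i w).
  (* Cutting is injective because [take i] and [drop i] determine the walk, and surjective by gluing
     at [c]. *)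
  have bij : set_bij (Wi i) (P i `*` Q (n - i)%N) split_at.
    split=> [w [sw [? ?]] //| |[u w] [/= Pu Qw]].
      move=> w w' _ _ [et ed]; rewrite -(cat_take_drop i w) -(cat_take_drop i w') ed.
      by rewrite -(take_takel w (leqnSn i)) et take_takel.
    have [su uc] := PP _ _ Pu; have [sw wc] := QP _ _ Qw.
    have [sz tk dp] := cat_walk_split su sw (etrans uc (esym wc)).
    exists (u ++ behead w); last by rewrite /split_at tk dp.
    by rewrite /Wi /= sz tk dp subnKC.
  have := has_sum_reindex bij PQ; congr (has_sum _ _).
  apply/funext => w; rewrite !patchE; case: ifP => // /set_mem [sw _] /=.
  by rewrite -(walk_weight_split _ i_n sw).
have := has_sum_sum sumWi; congr (has_sum _ _).
(* Existence and uniqueness of the cut make the indicator of [W n] the sum of the indicators of the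
   sets [Wi i]. *)
apply/funext => w; rewrite patchE; case: ifPn => [/set_mem Ww|/negP nW].
  have sw := sW _ _ Ww; have [i i_n [Pi Qi]] := (WP _ _ sw).1 Ww.
  have in1 : (i < n.+1)%N by [].
  rewrite (bigD1 (Ordinal in1)) //= {1}/patch mem_set // big1 ?addr0 //.
  move=> j ji; rewrite /patch memNset // => -[_ [Pj Qj]].
  case: (ltngtP i j) => [ij|ij|ij].
  - by apply: (uniqW n w i j); rewrite // ij leq_ord.
  - by apply: (uniqW n w j i); rewrite // ij.
  - by move/eqP: ji; apply; exact/val_inj/esym.
rewrite big1 // => i _; rewrite /patch memNset // => -[sw PQ].
by apply: nW; apply/mem_set/(WP _ _ sw); exists (i : nat); [exact: leq_ord|].
Qed.

(** * Relabelling and reversal of walks *)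

Lemma weight_of_bij (R : realType) (h : weight (cplx R)) (X Y : set (seq vertex)) g :
  set_bij X Y g ->
  (forall w, X w -> walk_weight h (g w) = walk_weight h w) ->
  abs_convergent Y (walk_weight h) ->
  abs_convergent X (walk_weight h) /\ weight_of h X = weight_of h Y.
Proof.
move=> bij gw absY; split.
  have [M gM] := abs_convergent_bij bij absY; exists M => A AX.
  apply: le_trans (gM A AX); rewrite big_seq [leRHS]big_seq.
  by apply: ler_sum => w /AX Xw /=; rewrite gw.
have [l Yl] := abs_convergent_has_sum absY.
rewrite /weight_of (has_sum_set_sum Yl); apply: has_sum_set_sum.
have := has_sum_reindex bij Yl; congr (has_sum _ _).
by apply/funext => w; rewrite !patchE; case: ifP => // /set_mem /gw.
Qed.

Lemma vtx_map (f : vertex -> vertex) (w : seq vertex) i :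
  (i < size w)%N -> vtx (map f w) i = f (vtx w i).
Proof. by move=> iw; rewrite /vtx (nth_map vertex1). Qed.

Lemma is_walk_map (f : vertex -> vertex) n w :
  injective f -> is_walk n (map f w) <-> is_walk n w.
Proof.
move=> finj; rewrite !is_walkP size_map; split=> -[sw wP]; split=> // i i_n;
  by have := wP _ i_n; rewrite !vtx_map ?sw ?ltnS ?(ltnW i_n) // (inj_eq finj).
Qed.

Lemma walk_weight_map (K : numFieldType) (h : weight K) (f : vertex -> vertex) n w :
  (forall a b, a != b -> edge_weight h (f a) (f b) = edge_weight h a b) ->
  is_walk n w -> walk_weight h (map f w) = walk_weight h w.
Proof.
move=> fh /is_walkP[sw wP]; rewrite /walk_weight size_map sw succnK.
apply: eq_big_nat => i /andP[_ i_n].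
by rewrite !vtx_map ?sw ?ltnS ?(ltnW i_n) // fh // wP.
Qed.

Lemma set_bij_map (f g : vertex -> vertex) (X Y : set (seq vertex)) :
  cancel f g -> cancel g f ->
  (forall w, X w -> Y (map f w)) -> (forall w, Y w -> X (map g w)) ->
  set_bij X Y (map f).
Proof.
move=> fK gK XY YX; split=> [w /XY //| |w /YX Xw].
  by move=> w w' _ _ /(inj_map (can_inj fK)).
by exists (map g w) => //; rewrite (mapK gK).
Qed.

(** Relabelling by [g], the inverse of the transitivity bijection, moves the start from [v] to 1.
    The sets [U] and [V] constrain the last vertex, so that walks with free end and closed walks are
    treated together. *)
Lemma weight_of_transitive (R : realType) (h : weight (cplx R)) v n (U V : set vertex)
    (f g : vertex -> vertex) :
  cancel f g -> cancel g f -> f vertex1 = v ->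
  (forall a b, a != b -> edge_weight h (f a) (f b) = edge_weight h a b) ->
  (forall a, U a <-> V (f a)) -> light h ->
  abs_convergent [set w | walks n v w /\ V (vtx w n)] (walk_weight h) /\
  weight_of h [set w | walks n v w /\ V (vtx w n)] =
  weight_of h [set w | walks1 n w /\ U (vtx w n)].
Proof.
move=> fK gK f1 fh UV lh.
have gh a b : a != b -> edge_weight h (g a) (g b) = edge_weight h a b.
  by move=> ab; rewrite -fh ?gK // (can_eq gK).
apply: (@weight_of_bij _ _ _ _ (map g)).
- apply: (set_bij_map gK fK) => w [[ww w0] wn]; have [sw _] := ww.
    split; first by split; [exact/(is_walk_map _ _ (can_inj gK))|
      rewrite vtx_map ?sw // w0 -f1 fK].
    by rewrite vtx_map ?sw //; apply/UV; rewrite gK.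
  split; first by split; [exact/(is_walk_map _ _ (can_inj fK))|
    rewrite vtx_map ?sw // w0].
  by rewrite vtx_map ?sw //; apply/UV.
- by move=> w [[ww _] _]; exact: walk_weight_map ww.
- by apply: abs_convergent_sub (lh n) => w [].
Qed.

Lemma edge_weightC (K : numFieldType) (h : weight K) a b :
  edge_weight h a b = edge_weight h b a.
Proof. by rewrite /edge_weight fsetUC. Qed.

Lemma vtx_rev n (w : seq vertex) i : size w = n.+1 -> (i <= n)%N ->
  vtx (rev w) i = vtx w (n - i).
Proof. by move=> sw i_n; rewrite /vtx nth_rev sw ?ltnS // subSS. Qed.

Lemma is_walk_rev n w : is_walk n w -> is_walk n (rev w).
Proof.
move=> /is_walkP[sw wP]; apply/is_walkP; rewrite size_rev; split=> // i i_n.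
rewrite !(vtx_rev sw) ?(ltnW i_n) // eq_sym -(subnSK i_n); apply: wP.
by rewrite ltn_subrL (leq_ltn_trans _ i_n).
Qed.

(** Reversal permutes the steps and exchanges the ends of each, which unordered edges do not
    distinguish. *)
Lemma walk_weight_rev (K : numFieldType) (h : weight K) n (w : seq vertex) :
  size w = n.+1 -> walk_weight h (rev w) = walk_weight h w.
Proof.
move=> sw; rewrite /walk_weight size_rev sw succnK big_nat_rev add0n.
apply: eq_big_nat => i /andP[_ i_n].
rewrite !(vtx_rev sw) ?leq_subr ?subSS ?subKn //; last first.
  by rewrite ltn_subrL (leq_ltn_trans _ i_n).
rewrite edge_weightC; congr edge_weight; congr vtx; lia.
Qed.

Lemma weight_of_rev (R : realType) (h : weight (cplx R)) u v n :
  abs_convergent [set w | walks n u w /\ vtx w n = v] (walk_weight h) ->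
  abs_convergent [set w | walks n v w /\ vtx w n = u] (walk_weight h) /\
  weight_of h [set w | walks n v w /\ vtx w n = u] =
  weight_of h [set w | walks n u w /\ vtx w n = v].
Proof.
have revP a b w : [set w | walks n a w /\ vtx w n = b] w ->
    [set w | walks n b w /\ vtx w n = a] (rev w).
  move=> [[ww w0] wn]; have [sw _] := ww; split; first split.
  - exact: is_walk_rev.
  - by rewrite (vtx_rev sw) // subn0.
  - by rewrite (vtx_rev sw) // subnn.
apply: (@weight_of_bij _ _ _ _ rev).
- split=> [w|w w' _ _|w /revP Xw]; [exact: revP|exact: (can_inj revK)|].
  by exists (rev w) => //; exact: revK.
- by move=> w [[[sw _] _] _]; exact: walk_weight_rev sw.
Qed.

(** * First and last visits *)

Lemma walks_split n u i w : (i <= n)%N -> size w = n.+1 ->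
  walks n u w <-> walks i u (take i.+1 w) /\ is_walk (n - i) (drop i w).
Proof.
move=> i_n sw; rewrite /walks /mkset (is_walk_split i_n sw) vtx_take //; tauto.
Qed.

Lemma vtx_mem n (w : seq vertex) (v : vertex) :
  size w = n.+1 -> v \in w <-> exists2 i, (i <= n)%N & vtx w i = v.
Proof.
move=> sw; split=> [vw|[i i_n <-]]; last by apply: mem_nth; rewrite sw.
by exists (index v w); [rewrite -ltnS -sw index_mem|exact: nth_index].
Qed.

(** The cut is at the first visit to [v]: the prefix is counted by [C_ser], and the rest is any walk
    from [v] with last vertex in [V]. *)
Lemma first_visit (R : realType) (h : weight (cplx R)) v (V : set vertex) :
  light h ->
  (forall n, abs_convergent [set w | walks n v w /\ V (vtx w n)] (walk_weight h)) ->
  (fun n => weight_of h [set w | [/\ walks1 n w, V (vtx w n) & v \in w]]) =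
  cauchy_prod (C_ser h v)
    (fun n => weight_of h [set w | walks n v w /\ V (vtx w n)]).
Proof.
move=> lh absV; apply: (@weight_of_concat _ _ _ _ _ v).
- by move=> i w [[[sw _] _] wi _].
- by move=> j w [[[sw _] w0] _].
- by move=> n w [[[sw _] _] _ _].
- move=> n w sw; split.
    move=> [ww wn /(vtx_mem _ sw)[k k_n /eqP wk]].
    have ex : exists k, vtx w k == v by exists k.
    case: (ex_minnP ex) => m /eqP wm minm.
    have m_n : (m <= n)%N by apply: leq_trans k_n; exact: minm.
    have [tw dw] := (walks_split _ m_n sw).1 ww.
    exists m => //; split; first split=> //.
    + by rewrite vtx_take.
    + move=> i im; rewrite vtx_take ?(ltnW im) //; apply/negP => /minm.
      by rewrite leqNgt im.
    + by split; rewrite ?vtx_drop ?addn0 ?subnKC //; split=> //; rewrite vtx_drop addn0.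
  move=> [i i_n [[tw wi _] [[dw _] dn]]].
  split; first by apply/(walks_split _ i_n sw).
    by move: dn; rewrite vtx_drop subnKC.
  by apply/(vtx_mem _ sw); exists i => //; rewrite -wi vtx_take.
(* Of two cuts, the longer prefix would visit [v] at the earlier cut, before its own end. *)
- move=> n w i j sw /andP[ij _] [_ wi _] _ [_ _ /(_ i ij)].
  by rewrite vtx_take ?(ltnW ij) // -{1}wi vtx_take // eqxx.
- by move=> i; apply: abs_convergent_sub (lh i) => w [].
- exact: absV.
Qed.

(** The cut is at the last visit to 1: before it the walk is closed at 1 and avoids [v], after it
    the walk meets neither 1 nor [v] until it ends at [v]. *)
Lemma last_visit1 (R : realType) (h : weight (cplx R)) v :
  v != vertex1 -> light h ->
  C_ser h v = cauchy_prod (Bv_ser h v) (E_ser h v).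
Proof.
move=> v1 lh; apply: (@weight_of_concat _ _ _ _ _ vertex1).
- by move=> i w [[[sw _] _] wi _].
- by move=> j w [[[sw _] w0] _ _].
- by move=> n w [[[sw _] _] _ _].
- move=> n w sw; split.
    move=> [ww wn wv]; have [_ w0] := ww.
    have ex : exists k, (k <= n)%N && (vtx w k == vertex1).
      by exists 0%N; rewrite w0 eqxx.
    have bd k : (k <= n)%N && (vtx w k == vertex1) -> (k <= n)%N by case/andP.
    case: (ex_maxnP ex bd) => m /andP[m_n /eqP wm] maxm.
    (* The last visit to 1 precedes the end of the walk, which is at [v]. *)
    have mn : (m < n)%N.
      rewrite ltn_neqAle m_n andbT; apply/eqP => mn.
      by move: v1; rewrite -wn -mn wm eqxx.
    have [tw dw] := (walks_split _ m_n sw).1 ww.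
    exists m => //; split; split=> //.
    + by rewrite vtx_take.
    + by move=> i im; rewrite vtx_take // wv // (leq_ltn_trans im).
    + by split=> //; rewrite vtx_drop addn0.
    + by rewrite vtx_drop subnKC.
    + move=> i /andP[i0 i_nm]; have i_n : (m + i < n)%N by rewrite -ltn_subRL.
      rewrite vtx_drop; split; last exact: wv.
      apply/negP => wmi; have := maxm (m + i)%N; rewrite (ltnW i_n) wmi => /(_ isT).
      by rewrite -{2}[m]addn0 leq_add2l leqNgt i0.
  move=> [i i_n [[tw wi tv] [[dw _] dn dv]]]; split.
  + by apply/(walks_split _ i_n sw).
  + by move: dn; rewrite vtx_drop subnKC.
  + move=> k kn; have [ki|ik] := leqP k i; first by have := tv _ ki; rewrite vtx_take.
    have [|_] := dv (k - i)%N; first by rewrite subn_gt0 ik ltn_sub2rE // ltnW.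
    by rewrite vtx_drop subnKC // ltnW.
(* A later cut [j] would place 1 inside the second piece of the cut at [i], or at its end [v] when
   [j = n]. *)
- move=> n w i j sw /andP[ij j_n] _ [_ dn dv] [_ wj _] _.
  move: wj dn; rewrite vtx_take // vtx_drop (subnKC (leq_trans (ltnW ij) j_n)) => wj dn.
  move: j_n; rewrite leq_eqVlt => /predU1P[jn|jn].
    by move: v1; rewrite -dn -jn wj eqxx.
  have [|] := dv (j - i)%N; first by rewrite subn_gt0 ij ltn_sub2rE // ltnW.
  by rewrite vtx_drop subnKC ?(ltnW ij) // wj eqxx.
- by move=> i; apply: abs_convergent_sub (lh i) => w [].
- by move=> i; apply: abs_convergent_sub (lh i) => w [].
Qed.

(** Isolates in the last term the closed walks to which the cut at the first visit to [v]
    applies. *)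
Lemma B_ser_avoid (R : realType) (h : weight (cplx R)) v n : light h ->
  B_ser h n = Bv_ser h v n +
    weight_of h [set w | [/\ walks1 n w, vtx w n = vertex1 & v \in w]].
Proof.
move=> lh; set Y := [set w | _]; rewrite /B_ser /Bv_ser.
set X := [set w | [/\ walks1 n w, _ & _]].
have [a Xa] : exists a, has_sum (walk_weight h \_ X) a.
  by apply: abs_convergent_has_sum; apply: abs_convergent_sub (lh n) => w [].
have [b Yb] : exists b, has_sum (walk_weight h \_ Y) b.
  by apply: abs_convergent_has_sum; apply: abs_convergent_sub (lh n) => w [].
rewrite /weight_of (has_sum_set_sum Xa) (has_sum_set_sum Yb).
apply: has_sum_set_sum; have := has_sumD Xa Yb; congr (has_sum _ _).
apply/funext => w; rewrite !patchE.
have [Ww|nW] := boolP (w \in [set w | walks1 n w /\ vtx w n = vertex1]); last first.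
  rewrite !memNset ?addr0 // => -[ww wn _]; move/negP: nW; apply; exact/mem_set.
have {Ww} [ww wn] := set_mem Ww; have [[sw _] _] := ww.
have [vw|nvw] := boolP (v \in w).
  rewrite (memNset (A := X)) ?(mem_set (A := Y)) ?add0r // => -[_ _ wv].
  by have [i i_n /eqP wi] := (vtx_mem _ sw).1 vw; have := wv _ i_n; rewrite wi.
rewrite (memNset (A := Y)) ?(mem_set (A := X)) ?addr0 //; last first.
  by move=> [_ _ vw]; rewrite vw in nvw.
split=> // i i_n; apply: contraNneq nvw => wi; apply/(vtx_mem _ sw).
by exists i.
Qed.

(** * Evaluation at 1 and conclusion *)

Lemma at1B (K : numFieldType) (u v : fps K) : exists_at1 u -> exists_at1 v ->
  exists_at1 (fun n => u n - v n) /\ at1 (fun n => u n - v n) = at1 u - at1 v.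
Proof.
move=> cu cv.
have uv : partial_sums (fun n => u n - v n) @ \oo --> at1 u - at1 v.
  rewrite (_ : partial_sums _ = partial_sums u \- partial_sums v).
    exact: cvgB cu cv.
  by apply/funext => n; rewrite /partial_sums sumrB.
split; first by apply/cvg_ex; exists (at1 u - at1 v).
by apply: (cvg_lim _ uv); exact: norm_hausdorff.
Qed.

Lemma at1_quotient (K : numFieldType) (A B Bv C D E : fps K) :
  archimedean K ->
  A = cauchy_prod C D -> C = cauchy_prod Bv E ->
  (fun n => B n - Bv n) = cauchy_prod C (cauchy_prod C B) ->
  exists_at1 A -> exists_at1 B -> exists_at1 Bv -> exists_at1 C ->
  exists_at1 D -> exists_at1 E ->
  times_sqrt (at1 D) (1 - quot (at1 Bv) (at1 B)) (at1 A) /\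
  (at1 B = 0 -> at1 Bv = 0 /\ at1 A = 0).
Proof.
move=> arch AE CE BBv hA hB hBv hC hD hE.
have [cBBv eBBv] := at1B hB hBv.
(* The three product series equal [A], [C] and the difference of [B] and [Bv], so they converge, as
   multiplying the sums requires. *)
have A1 : at1 A = at1 C * at1 D.
  by rewrite {1}AE at1_cauchy_prod // -AE.
have C1 : at1 C = at1 Bv * at1 E.
  by rewrite {1}CE at1_cauchy_prod // -CE.
have B1 : at1 B - at1 Bv = at1 C * at1 C * at1 B.
  by rewrite -eBBv BBv at1_cauchy_prod3 // -BBv.
have B0 : at1 B = 0 -> at1 Bv = 0 /\ at1 A = 0.
  move=> B0; move: B1; rewrite B0 mulr0 sub0r => /eqP; rewrite oppr_eq0 => /eqP Bv0.
  by rewrite A1 C1 Bv0 !mul0r.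
split=> //; have [B_0|B_neq0] := eqVneq (at1 B) 0.
  (* With 0 / 0 read as 1 the radicand vanishes, so its root is 0. *)
  have [Bv0 A0] := B0 B_0; exists 0; last by rewrite A0 mulr0.
  by rewrite /= /quot Bv0 B_0 eqxx subrr expr0n.
exists (at1 C); last by rewrite A1 mulrC.
rewrite /= /quot (negbTE B_neq0) andbF -[X in X - _](divff B_neq0) -mulrBl B1.
by rewrite mulfK.
Qed.

Theorem mainTheorem8 (R : realType) (v : vertex) (h : weight R[i]%C)
    (hv : v != vertex1)
    (htrans : transitive_at h v)
    (hlight : light h)
    (hreach : reachable h v)
    (hE : exists_at1 (E_ser h v))
    (hD : exists_at1 (D_ser h))
    (hC : exists_at1 (C_ser h v))
    (hBv : exists_at1 (Bv_ser h v))
    (hB : exists_at1 (B_ser h))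
    (hA : exists_at1 (A_ser h v)) :
  times_sqrt (at1 (D_ser h)) (1 - quot (at1 (Bv_ser h v)) (at1 (B_ser h)))%R
    (at1 (A_ser h v)) /\
  (at1 (B_ser h) = 0%R -> at1 (Bv_ser h v) = 0%R /\ at1 (A_ser h v) = 0%R).
Proof.
have [f [[g fK gK] f1 fh]] := htrans.
have finj := can_inj fK.
(* [G] counts all walks from 1 to [v]; it mediates between the two factors [C_ser] in the formula
   for [B_ser]. *)
pose G n := weight_of h [set w | walks1 n w /\ vtx w n = v].
have AE : A_ser h v = cauchy_prod (C_ser h v) (D_ser h).
  have fT n := @weight_of_transitive R h v n setT setT f g fK gK f1 fh
    (fun _ => conj id id) hlight.
  rewrite (_ : D_ser h = fun n => weight_of h
    [set w | walks n v w /\ setT (vtx w n)]).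
    rewrite -first_visit //; last by move=> n; have [] := fT n.
    apply/funext => n; congr weight_of; apply/seteqP; split=> w; by case.
  apply/funext => n; have [_ ->] := fT n.
  congr weight_of; apply/seteqP; split=> w; [by split|by case].
have GE : G = cauchy_prod (C_ser h v) (B_ser h).
  have f1v a : [set vertex1] a <-> [set v] (f a).
    by rewrite /= -f1; split=> [->|/finj].
  have fT n := @weight_of_transitive R h v n [set vertex1] [set v] f g fK gK f1 fh
    f1v hlight.
  rewrite (_ : B_ser h = fun n => weight_of h
    [set w | walks n v w /\ [set v] (vtx w n)]).
    rewrite -first_visit //; last by move=> n; have [] := fT n.
    apply/funext => n; congr weight_of; apply/seteqP; split=> w; last by case.
    (* A walk ending at [v] visits [v], so the visit condition of [first_visit] holds. *)
    move=> [ww wn]; split=> //; have [[sw _] _] := ww.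
    by apply/(vtx_mem _ sw); exists n.
  by apply/funext => n; have [_ ->] := fT n.
(* After the first visit to [v] there remains a walk from [v] to 1. Since [f] need not send [v] to
   1, reversal rather than transitivity relates these walks to [G]. *)
have XE : (fun n => weight_of h
      [set w | [/\ walks1 n w, vtx w n = vertex1 & v \in w]]) =
    cauchy_prod (C_ser h v) G.
  have revG n := @weight_of_rev R h vertex1 v n
    (abs_convergent_sub (fun w => @proj1 _ _) (hlight n)).
  rewrite (first_visit (V := [set vertex1])) //; last by move=> n; have [] := revG n.
  by congr cauchy_prod; apply/funext => n; have [_ ->] := revG n.
have CE := last_visit1 hv hlight.
have BBv : (fun n => B_ser h n - Bv_ser h v n) =
    cauchy_prod (C_ser h v) (cauchy_prod (C_ser h v) (B_ser h)).
  rewrite -GE -XE; apply/funext => n.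
  by rewrite (B_ser_avoid v n hlight) addrAC subrr add0r.
exact (at1_quotient (@complex_archimedean R) AE CE BBv hA hB hBv hC hD hE).
Qed.
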